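(* Let $G_\phi$ and $G_\psi$ be signed graphs (on the same underlying graph $G$, with the same sink $q$) that are switching equivalent. Then there is an isomorphism of critical groups $\mathcal{K}(G_\phi)\cong\mathcal{K}(G_\psi)$.
   Context: A signed graph $G_\phi$ is a finite simple graph $G=(V,E)$ with a sign function $\phi:E\to\{+,-\}$. Switching a vertex $v\in V$ means reversing the sign of every edge incident to $v$. Two signed graphs with the same underlying graph are switching equivalent if one is obtained from the other by a finite sequence of vertex switchings. A vertex $q$ is chosen as sink and $v_1,\dots,v_n$ are the other (nonsink) vertices. The reduced signed Laplacian $L_{G_\phi}$ is the $n\times n$ matrix with diagonal entries $\deg_G(v_i)$ (counting edges to $q$) and, for $i\neq j$, $(i,j)$ entry $-1$ if $v_iv_j$ is a positive edge, $+1$ if it is a negative edge, $0$ if it is not an edge. The critical group is $\mathcal{K}(G_\phi)=\mathbb{Z}^n/\mathrm{im}\,L_{G_\phi}$. *)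

(* Defs.v *)
From HB Require Import structures.
From mathcomp Require Import all_boot all_order all_algebra.
From mathcomp Require Import boolp.

Set Implicit Arguments.
Unset Strict Implicit.
Unset Printing Implicit Defensive.

Import GRing.Theory.
Local Open Scope ring_scope.

Record sgraph (V : finType) := SGraph {
  edges : {set {set V}};
  edges_card2 : forall e, e \in edges -> #|e| = 2%N
}.

Inductive sign := Plus | Minus.

Definition flip (s : sign) : sign :=
  match s with Plus => Minus | Minus => Plus end.

Notation edge G := {e : {set _} | e \in edges G}.

Definition signing (V : finType) (G : sgraph V) := {ffun edge G -> sign}.

Section SignedGraph.

Variables (V : finType) (G : sgraph V).
Implicit Type phi : signing G.

Definition switch phi (x : V) : signing G :=
  [ffun e : edge G => if x \in val e then flip (phi e) else phi e].

(* Any vertex may be switched, the sink included. *)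
Definition switching_equivalent phi psi : Prop :=
  exists s : seq V, psi = foldl switch phi s.

Definition degree (x : V) : nat := #|[set e in edges G | x \in e]|.

(* [insub] yields [Some e] exactly when {x, y} is an edge of G. *)
Definition signed_adj phi (x y : V) : int :=
  if insub [set x; y] is Some e then
    match phi e with Plus => 1 | Minus => -1 end
  else 0.

Definition nonsink_enum (q : V) (n : nat) (v : 'I_n -> V) : Prop :=
  injective v /\ codom v =i predC1 q.

Definition reduced_laplacian phi (n : nat) (v : 'I_n -> V) : 'M[int]_n :=
  \matrix_(i, j) if i == j then (degree (v i))%:Z
                 else - signed_adj phi (v i) (v j).

End SignedGraph.

(* The image of L in Z^n, as a boolean predicate so that the library's
   quotient of a zmodType by a subgroup applies. *)
Definition im_mx (n : nat) (L : 'M[int]_n) : {pred 'cV[int]_n} :=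
  fun u => `[< exists x : 'cV[int]_n, u = L *m x >].

Lemma im_mx_zmod_closed (n : nat) (L : 'M[int]_n) : zmod_closed (im_mx L).
Proof.
split; first by apply/asboolP; exists 0; rewrite mulmx0.
move=> _ _ /asboolP[x ->] /asboolP[y ->].
by apply/asboolP; exists (x - y); rewrite mulmxBr.
Qed.

HB.instance Definition _ (n : nat) (L : 'M[int]_n) :=
  GRing.isZmodClosed.Build 'cV[int]_n (im_mx L) (im_mx_zmod_closed L).

Definition coker_mx (n : nat) (L : 'M[int]_n) : zmodType :=
  Quotient.quot (im_mx L).

Definition critical_group (V : finType) (G : sgraph V) (phi : signing G)
    (n : nat) (v : 'I_n -> V) : zmodType :=
  coker_mx (reduced_laplacian phi v).

Definition zmod_isog (A B : zmodType) : Prop :=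
  exists f : {additive A -> B}, bijective f.

(* Main.v *)
From HB Require Import structures.
Require Import Defs.
From mathcomp Require Import all_boot all_order all_algebra.
From mathcomp Require Import boolp.

Import GRing.Theory.
Local Open Scope ring_scope.
Local Open Scope quotient_scope.

(** Write eps x = -1 if the vertex x is switched an odd number of times and
    eps x = 1 otherwise. An edge changes sign once for each switching of either
    of its ends, so the sequence of switchings multiplies the signed adjacency
    of x and y by eps x * eps y (lemma [signed_adj_foldl_switch]). The degrees
    do not see the signs, and eps x * eps x = 1; hence the reduced Laplacians
    satisfy L_psi = D L_phi D, where D is the diagonal matrix of the signs eps
    of the nonsink vertices (lemma [reduced_laplacian_switch]). The sink has no
    row in D, which is why switching it leaves the reduced Laplacian unchanged.

    As D is its own inverse, L_phi and L_psi are equivalent over the integers,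
    and equivalent matrices have isomorphic cokernels (lemma
    [coker_mx_equiv]): if N = P M Q with P and Q invertible, then
    multiplication by P carries the image of M onto the image of N. *)

Lemma in_im_mxP n (L : 'M[int]_n) (u : 'cV[int]_n) :
  reflect (exists x : 'cV[int]_n, u = L *m x) (u \in im_mx L).
Proof. exact: asboolP. Qed.

(** Multiplication by P on chosen representatives; it is independent of the
    choice, hence additive, as soon as P maps the image of M into that of N. *)
Definition coker_map {n} (M N P : 'M[int]_n) (a : coker_mx M) : coker_mx N :=
  \pi_(coker_mx N) (P *m repr a).

Section CokerMap.

Variables (n : nat) (M N P : 'M[int]_n).
Hypothesis im_sub : forall u, u \in im_mx M -> P *m u \in im_mx N.

Lemma coker_map_pi u :
  coker_map M N P (\pi_(coker_mx M) u) = \pi_(coker_mx N) (P *m u).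
Proof.
apply/eqP; rewrite /coker_map -Quotient.idealrBE -mulmxBr im_sub //.
by rewrite Quotient.idealrBE reprK.
Qed.

Lemma coker_map_is_zmod_morphism : zmod_morphism (coker_map M N P).
Proof.
move=> a b; rewrite -[a]reprK -[b]reprK -raddfB !coker_map_pi.
by rewrite mulmxBr raddfB.
Qed.

End CokerMap.

Lemma coker_map_cancel n (M N P P' : 'M[int]_n) :
    (forall u, u \in im_mx M -> P *m u \in im_mx N) ->
    (forall u, u \in im_mx N -> P' *m u \in im_mx M) ->
  P' *m P = 1%:M -> cancel (coker_map M N P) (coker_map N M P').
Proof.
move=> sMN sNM P'P a; rewrite -[a]reprK (coker_map_pi _ _ _ _ sMN).
by rewrite (coker_map_pi _ _ _ _ sNM) mulmxA P'P mul1mx.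
Qed.

(** With N = P M Q, P (M x) = N (Q^-1 x) and P^-1 (N x) = M (Q x), so that P and
    P^-1 exchange the two images and induce inverse maps on the cokernels. *)
Lemma coker_mx_equiv n (M N P Q : 'M[int]_n) :
    P \in unitmx -> Q \in unitmx -> N = P *m M *m Q ->
  zmod_isog (coker_mx M) (coker_mx N).
Proof.
move=> uP uQ defN.
have sMN u : u \in im_mx M -> P *m u \in im_mx N.
  case/in_im_mxP=> x ->; apply/in_im_mxP; exists (invmx Q *m x).
  by rewrite defN !mulmxA mulmxK.
have sNM u : u \in im_mx N -> invmx P *m u \in im_mx M.
  case/in_im_mxP=> x ->; apply/in_im_mxP; exists (Q *m x).
  by rewrite defN -!mulmxA mulKmx.
pose f := GRing.isZmodMorphism.Build _ _ _
  (coker_map_is_zmod_morphism _ _ _ _ sMN).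
pose F : {additive coker_mx M -> coker_mx N} :=
  HB.pack (coker_map M N P) f.
exists F; exists (coker_map N M (invmx P)).
- by apply: coker_map_cancel; rewrite ?mulVmx.
- by apply: coker_map_cancel; rewrite ?mulmxV.
Qed.

Section Switching.

Variables (V : finType) (G : sgraph V).
Implicit Types (phi : signing G) (s : seq V).

(** An edge {x, y} is reversed by switching z exactly when one of x and y is
    z; both cannot be, since an edge has two distinct ends. *)
Lemma signed_adj_switch phi z x y :
  signed_adj (switch phi z) x y
    = (-1) ^+ (z == x) * (-1) ^+ (z == y) * signed_adj phi x y.
Proof.
rewrite /signed_adj; case: insubP => [e e_edge def_e | _]; last by rewrite mulr0.
have neq_xy : x != y.
  by have := edges_card2 e_edge; rewrite cards2; case: (x != y).
rewrite ffunE def_e !inE.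
have [-> | _] := eqVneq z x.
  by rewrite (negPf neq_xy) mulr1 mulN1r; case: (phi e); rewrite ?opprK.
rewrite mul1r; case: (z == y); rewrite ?mulN1r ?mul1r //.
by case: (phi e); rewrite ?opprK.
Qed.

Definition switch_sign s (x : V) : int := (-1) ^+ count_mem x s.

Lemma switch_sign_sqr s x : switch_sign s x * switch_sign s x = 1.
Proof. by rewrite -expr2 sqrr_sign. Qed.

Lemma signed_adj_foldl_switch phi s x y :
  signed_adj (foldl (@switch V G) phi s) x y
    = switch_sign s x * switch_sign s y * signed_adj phi x y.
Proof.
elim: s phi => [|z s IHs] phi; first by rewrite /switch_sign /= !mul1r.
rewrite /= IHs signed_adj_switch /switch_sign /= !exprD mulrA; congr (_ * _).
by rewrite [RHS]mulrACA [RHS]mulrC.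
Qed.

Definition switch_mx s n (v : 'I_n -> V) : 'M[int]_n :=
  diag_mx (\row_i switch_sign s (v i)).

Lemma switch_mx_sqr s n (v : 'I_n -> V) :
  switch_mx s n v *m switch_mx s n v = 1%:M.
Proof.
rewrite mulmx_diag -diag_const_mx; congr diag_mx.
by apply/rowP=> i; rewrite !mxE switch_sign_sqr.
Qed.

Lemma reduced_laplacian_switch phi s n (v : 'I_n -> V) :
  reduced_laplacian (foldl (@switch V G) phi s) v
    = switch_mx s n v *m reduced_laplacian phi v *m switch_mx s n v.
Proof.
apply/matrixP=> i j; rewrite mul_mx_diag mul_diag_mx !mxE.
case: eqVneq => [<- | _]; first by rewrite mulrAC switch_sign_sqr mul1r.
by rewrite signed_adj_foldl_switch mulrN mulNr mulrAC.
Qed.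

End Switching.

Theorem lemma4p2 (V : finType) (G : sgraph V) (q : V)
    (n : nat) (v : 'I_n -> V) (hv : nonsink_enum q v)
    (phi psi : signing G) (hsw : switching_equivalent phi psi) :
  zmod_isog (critical_group phi v) (critical_group psi v).
Proof.
case: hsw => s ->.
have [uD _] := mulmx1_unit (switch_mx_sqr V s n v).
exact: (coker_mx_equiv _ _ _ _ _ uD uD (reduced_laplacian_switch V G phi s n v)).
Qed.
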